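(* Let $\alpha\in[0,1]$. For all vectors $u=(u_1,u_2,u_3)$ and $v=(v_1,v_2,v_3)$ in $\mathbb{R}^3$, $$\|u+v\|_\alpha\le \|u\|_\alpha+\|v\|_\alpha .$$
   Context: For $\alpha\in[0,1]$ and $w=(w_1,w_2,w_3)\in\mathbb{R}^3$, define $\|w\|_\alpha=\sqrt{w_1^2+w_2^2+w_3^2-2(1-\alpha)w_2w_3}$. (The radicand is nonnegative for $\alpha\in[0,1]$; for $\alpha=0$ this is only a seminorm.) The Trinition space $T_\alpha$ is $\mathbb{R}^3$ equipped with $\|\cdot\|_\alpha$. *)

(* Defs.v *)
From mathcomp Require Import all_boot all_order all_algebra.
From mathcomp Require Import reals.

Set Implicit Arguments.
Unset Strict Implicit.
Unset Printing Implicit Defensive.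

Import Order.TTheory GRing.Theory Num.Theory.
Local Open Scope ring_scope.

(* Coordinates are numbered from 0: (w_1, w_2, w_3) is (w 0 0, w 0 1, w 0 2).
   Num.sqrt is 0 on negative arguments; for 0 <= alpha <= 1 the radicand is
   nonnegative, so this convention plays no role there. *)
Definition trinition_norm (R : realType) (alpha : R) (w : 'rV[R]_3) : R :=
  Num.sqrt (w 0 0 ^+ 2 + w 0 1 ^+ 2 + w 0 2 ^+ 2
            - 2 * (1 - alpha) * w 0 1 * w 0 2).

(* Main.v *)
Require Import Defs.
From mathcomp Require Import all_boot all_order all_algebra.
From mathcomp Require Import reals.
From mathcomp Require Import ring lra.

Set Implicit Arguments.
Unset Strict Implicit.
Unset Printing Implicit Defensive.

Import Order.TTheory GRing.Theory Num.Theory.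
Local Open Scope ring_scope.

(** With [c = 1 - alpha], completing the square in the second coordinate gives
    [w1^2 + w2^2 + w3^2 - 2 c w2 w3 = w1^2 + (w2 - c w3)^2 + (1 - c^2) w3^2],
    and [1 - c^2 = alpha (2 - alpha)] is nonnegative for [alpha] in [0, 1].  In
    the coordinates [(w1, w2 - c w3, w3)] the radicand is therefore a diagonal
    form with weights [1, 1, d], [d >= 0].  Lagrange's identity gives
    Cauchy-Schwarz for such a form even when it is degenerate ([d = 0]), and
    Cauchy-Schwarz gives the triangle inequality in the usual way
    ([sqrt_triangle]). *)

(** Squaring reduces the claim to [B <= sqrt A * sqrt C].  Here [A] and [C]
    stand for the values of a quadratic form at two vectors and [B] for its
    polar form, so that the form is [A + 2 B + C] at their sum. *)
Lemma sqrt_triangle (R : rcfType) (A B C : R) :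
  0 <= A -> 0 <= C -> B ^+ 2 <= A * C ->
  Num.sqrt (A + 2 * B + C) <= Num.sqrt A + Num.sqrt C.
Proof.
move=> A0 C0 BAC.
have leB : B <= Num.sqrt A * Num.sqrt C.
  by rewrite -sqrtrM // (le_trans (ler_norm B)) // -sqrtr_sqr ler_wsqrtr.
have sum_ge0 : 0 <= Num.sqrt A + Num.sqrt C by rewrite addr_ge0 ?sqrtr_ge0.
rewrite -[leRHS]ger0_norm // -sqrtr_sqr ler_wsqrtr // sqrrD !sqr_sqrtr //.
lra.
Qed.

Lemma diag_form_ge0 (R : realDomainType) (d x y z : R) :
  0 <= d -> 0 <= x ^+ 2 + y ^+ 2 + d * z ^+ 2.
Proof.
by move=> d0; do !apply: addr_ge0; rewrite ?sqr_ge0 //; apply: mulr_ge0 (sqr_ge0 z).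
Qed.

(** Lagrange's identity: the difference of the two sides is a combination of
    the squared 2 x 2 minors with weights the products of pairs of the weights
    [1, 1, d]. *)
Lemma diag_form_Cauchy_Schwarz (R : realDomainType) (d x y z x' y' z' : R) :
  0 <= d ->
  (x * x' + y * y' + d * (z * z')) ^+ 2 <=
  (x ^+ 2 + y ^+ 2 + d * z ^+ 2) * (x' ^+ 2 + y' ^+ 2 + d * z' ^+ 2).
Proof.
move=> d0; rewrite -subr_ge0.
have -> : (x ^+ 2 + y ^+ 2 + d * z ^+ 2) * (x' ^+ 2 + y' ^+ 2 + d * z' ^+ 2)
    - (x * x' + y * y' + d * (z * z')) ^+ 2
  = (x * y' - y * x') ^+ 2 + d * (x * z' - z * x') ^+ 2
    + d * (y * z' - z * y') ^+ 2 by ring.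
by do !apply: addr_ge0; rewrite ?sqr_ge0 //; apply: mulr_ge0 (sqr_ge0 _).
Qed.

Lemma trinition_normE (R : realType) (alpha : R) (w : 'rV[R]_3) :
  trinition_norm alpha w =
  Num.sqrt (w 0 0 ^+ 2 + (w 0 1 - (1 - alpha) * w 0 2) ^+ 2
            + alpha * (2 - alpha) * w 0 2 ^+ 2).
Proof. by rewrite /trinition_norm; congr Num.sqrt; ring. Qed.

Theorem mainTheorem1 (R : realType) (alpha : R) (halpha : 0 <= alpha <= 1)
    (u v : 'rV[R]_3) :
  trinition_norm alpha (u + v) <= trinition_norm alpha u + trinition_norm alpha v.
Proof.
have d0 : 0 <= alpha * (2 - alpha).
  by case/andP: halpha => a0 a1; rewrite mulr_ge0 //; lra.
rewrite !trinition_normE !mxE.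
set d := alpha * (2 - alpha) in d0 *.
set yu := u 0 1 - (1 - alpha) * u 0 2; set yv := v 0 1 - (1 - alpha) * v 0 2.
have CS := diag_form_Cauchy_Schwarz (u 0 0) yu (u 0 2) (v 0 0) yv (v 0 2) d0.
apply: le_trans (sqrt_triangle _ _ CS); rewrite ?diag_form_ge0 //.
rewrite le_eqVlt; apply/orP; left; apply/eqP; congr Num.sqrt.
by rewrite /yu /yv; ring.
Qed.
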